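(* Let $\{x^k\}$ be the sequence generated by the DCA-Like algorithm (described in the context). The following statements hold. (i) The sequence $\{\varphi(x^k,g(x^k))\}$ is decreasing (nonincreasing). More precisely, for all $k\ge 0$, $$\varphi(x^k,g(x^k))-\varphi(x^{k+1},g(x^{k+1}))\ \ge\ \frac{\mu_k}{2}\|x^{k+1}-x^k\|^2 .$$ (ii) If $\alpha=\inf\varphi(x,z)>-\infty$, then $\sum_{k=0}^{+\infty}\|x^{k+1}-x^k\|^2<+\infty$, and therefore $\lim_{k\to+\infty}\|x^{k+1}-x^k\|=0$. (iii) If $\alpha=\inf\varphi(x,z)>-\infty$, then any limit point of $\{(x^k,g(x^k))\}$ is a critical point of the problem $\min_{(x,z)}\varphi(x,z)$.
   Context: Setting. $n=\sum_{i=1}^m n_i$, and $x\in\mathbb{R}^n$ is written in blocks $x=(x_1,\dots,x_m)$ with $x_i\in\mathbb{R}^{n_i}$. $X\subset\mathbb{R}^n$ is a closed convex set. $f:\mathbb{R}^n\to\mathbb{R}$ is continuously differentiable (possibly nonconvex) with $L$-Lipschitz continuous gradient. For $i=1,\dots,m$, $g_i:\mathbb{R}^{n_i}\to\mathbb{R}$ is a continuous convex (possibly nonsmooth) function. For $i=1,\dots,m$, $h_i:D_i\to\mathbb{R}$ is concave and increasing (in the sense of nondecreasing), where $D_i\subset\mathbb{R}$ is an open interval, unbounded above, containing $g_i(x_i)$ for all $x\in X$; and the convex subdifferential satisfies $\partial(-h_i)(t)\subset(-\infty,0]$ whenever $t\ge g_i(x_i)$ for some $x\in X$. Notation. $g(x)=(g_1(x_1),\dots,g_m(x_m))\in\mathbb{R}^m$;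 $\Omega=\{(x,z)\in\mathbb{R}^n\times\mathbb{R}^m: x\in X,\ g_i(x_i)\le z_i,\ i=1,\dots,m\}$; $\chi_\Omega=0$ on $\Omega$ and $+\infty$ elsewhere; $$\varphi(x,z)=\chi_\Omega(x,z)+f(x)+\sum_{i=1}^m h_i(z_i)$$ (equal to $+\infty$ outside $\Omega$). For $\mu>0$: $G_\mu(x,z)=\frac{\mu}{2}\|x\|^2+\chi_\Omega(x,z)$ and $H_\mu(x,z)=\frac{\mu}{2}\|x\|^2-f(x)-\sum_{i=1}^m h_i(z_i)$, so $\varphi=G_\mu-H_\mu$; for $\mu\ge L$ both are convex. Norms are Euclidean. Critical point. $(x^*,z^* )$ is a critical point of $\min\varphi$ if $\partial H_\mu(x^*,z^* )\cap\partial G_\mu(x^*,z^* )\neq\emptyset$ (convex subdifferentials) for $\mu\ge L$, $\mu>0$; here $\partial H_\mu(x,z)=\{\mu x-\nabla f(x)\}\times\prod_{i=1}^m\partial(-h_i)(z_i)$, and the condition does not depend on the choice of $\mu$. DCA-Like algorithm. Inputs: $x^0\in X$, $\eta>1$, $0<\delta<1$, $\underline{\mu}>0$. For $k=0,1,2,\dots$ (run without stopping, producing an infinite sequence): 1. Choose $\xi_i^k\in\partial(-h_i)(g_i(x_i^k))$, $i=1,\dots,m$, put $\xi^k=(\xi^k_1,\dots,\xi^k_m)$, and compute $\nabla f(x^k)$. 2. Set $\mu_k=\underline{\mu}$ if $k=0$, and $\mu_k=\max\{\underline{\mu},\delta\mu_{k-1}\}$ if $k>0$. 3. Let $x^{k+1}$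 be the minimizer over $x\in X$ of $\frac{\mu_k}{2}\|x-x^k\|^2+\langle\nabla f(x^k),x\rangle+\sum_{i=1}^m(-\xi_i^k)g_i(x_i)$. 4. While $H_{\mu_k}(x^{k+1},g(x^{k+1}))<H_{\mu_k}(x^k,g(x^k))+\langle\mu_kx^k-\nabla f(x^k),x^{k+1}-x^k\rangle+\langle\xi^k,g(x^{k+1})-g(x^k)\rangle$, replace $\mu_k$ by $\eta\mu_k$ and recompute $x^{k+1}$ by step 3. In the claim, $\mu_k$ denotes the final value of $\mu_k$ at iteration $k$, after step 4. *)

(* Defs.v *)
From HB Require Import structures.
From mathcomp Require Import all_boot all_order all_algebra.
From mathcomp Require Import all_classical all_reals all_analysis.
Import Order.TTheory GRing.Theory Num.Theory numFieldNormedType.Exports.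

Set Implicit Arguments.
Unset Strict Implicit.
Unset Printing Implicit Defensive.

Local Open Scope classical_set_scope.
Local Open Scope ring_scope.

Section euclidean.
Context {R : realType}.

Definition dot n (u v : 'rV[R]_n) : R := \sum_(j < n) u 0 j * v 0 j.

(* The library norm `|u| on matrices is the sup norm, hence a separate
   Euclidean norm (the topology is the same). *)
Definition enorm n (u : 'rV[R]_n) : R := Num.sqrt (dot u u).

Definition dot_pair n m (p q : 'rV[R]_n * 'rV[R]_m) : R :=
  dot p.1 q.1 + dot p.2 q.2.

Definition gradient n (f : 'rV[R]_n -> R) (x : 'rV[R]_n) : 'rV[R]_n :=
  \row_(j < n) 'D_(delta_mx 0 j) f x.

(* Convex subdifferential of F : V -> ]-oo, +oo] with respect to the inner
   product ip; it is empty outside the effective domain of F. *)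
Definition subdiff (V : zmodType) (ip : V -> V -> R) (F : V -> \bar R) (p : V) :
    set V :=
  [set v | F p \is a fin_num /\
           forall q, (F p + (ip v (q - p))%:E <= F q)%E].

(* Extension of a function defined on D by +oo; values of F outside D are
   ignored. *)
Definition extend_pinfty T (D : set T) (F : T -> R) (t : T) : \bar R :=
  if t \in D then (F t)%:E else +oo%E.

Definition chi T (D : set T) : T -> \bar R := extend_pinfty D (fun=> 0).

Definition is_minimizer T (D : set T) (F : T -> R) (x : T) : Prop :=
  D x /\ forall y, D y -> F x <= F y.

End euclidean.

(* R^n is 'rV[R]_(\sum_i n_ i), and the i-th block of x is submxrow x i. *)
Section problem.
Context {R : realType} {m : nat} {n_ : 'I_m -> nat}.
Local Notation n := (\sum_(i < m) n_ i)%N.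
Context (X : set 'rV[R]_n) (f : 'rV[R]_n -> R).
Context (g : forall i : 'I_m, 'rV[R]_(n_ i) -> R).
Context (D : 'I_m -> set R) (h : 'I_m -> R -> R).

Definition gvec (x : 'rV[R]_n) : 'rV[R]_m := \row_(i < m) g (submxrow x i).

Definition Omega : set ('rV[R]_n * 'rV[R]_m) :=
  [set p : 'rV_n * 'rV_m | X p.1 /\ forall i, g (submxrow p.1 i) <= p.2 0 i].

(* Off Omega the value is +oo whatever h is; on Omega, every z_i lies in D i as
   soon as D i is an interval, unbounded above, containing the g_i (x_i) for x
   in X. *)
Definition phi (p : 'rV[R]_n * 'rV[R]_m) : \bar R :=
  (chi Omega p + (f p.1 + \sum_(i < m) h i (p.2 0 i))%:E)%E.

Definition neg_h (i : 'I_m) : R -> \bar R :=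
  extend_pinfty (D i) (fun t => - h i t).

Definition subdiff_neg_h (i : 'I_m) (t : R) : set R :=
  subdiff *%R (neg_h i) t.

Definition G_mu (mu : R) (p : 'rV[R]_n * 'rV[R]_m) : \bar R :=
  ((mu / 2 * enorm p.1 ^+ 2)%:E + chi Omega p)%E.

Definition H_mu (mu : R) (p : 'rV[R]_n * 'rV[R]_m) : \bar R :=
  ((mu / 2 * enorm p.1 ^+ 2 - f p.1)%:E + \sum_(i < m) neg_h i (p.2 0%R i))%E.

(* L is the Lipschitz constant of the gradient of f. The condition does not
   depend on mu, so it is required of all admissible mu. *)
Definition critical_point (L : R) (p : 'rV[R]_n * 'rV[R]_m) : Prop :=
  forall mu, 0 < mu -> L <= mu ->
    subdiff (@dot_pair R n m) (H_mu mu) p `&`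
    subdiff (@dot_pair R n m) (G_mu mu) p !=set0.

Definition subproblem (mu : R) (x : 'rV[R]_n) (xi : 'rV[R]_m) (y : 'rV[R]_n) : R :=
  mu / 2 * enorm (y - x) ^+ 2 + dot (gradient f x) y
  + \sum_(i < m) - xi 0 i * g (submxrow y i).

Definition must_increase (mu : R) (x : 'rV[R]_n) (xi : 'rV[R]_m) (y : 'rV[R]_n) :
    Prop :=
  (H_mu mu (y, gvec y) <
   H_mu mu (x, gvec x) +
   (dot (mu *: x - gradient f x) (y - x) + dot xi (gvec y - gvec x))%:E)%E.

(* backtrack eta x xi mu0 mu y: started at mu0, the step-size loop terminates
   with final parameter mu and final point y. *)
Inductive backtrack (eta : R) (x : 'rV[R]_n) (xi : 'rV[R]_m) :
    R -> R -> 'rV[R]_n -> Prop :=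
| backtrack_stop mu y :
    is_minimizer X (subproblem mu x xi) y ->
    ~ must_increase mu x xi y ->
    backtrack eta x xi mu mu y
| backtrack_increase mu y mu' y' :
    is_minimizer X (subproblem mu x xi) y ->
    must_increase mu x xi y ->
    backtrack eta x xi (eta * mu) mu' y' ->
    backtrack eta x xi mu mu' y'.

(* mu k is the final value of the parameter at iteration k. *)
Definition mu_start (delta mu_low : R) (mu : nat -> R) (k : nat) : R :=
  if k is k'.+1 then Num.max mu_low (delta * mu k') else mu_low.

Definition dca_like (eta delta mu_low : R)
    (x : nat -> 'rV[R]_n) (xi : nat -> 'rV[R]_m) (mu : nat -> R) : Prop :=
  X (x 0%N) /\
  forall k,
    (forall i, subdiff_neg_h i (g (submxrow (x k) i)) (xi k 0 i)) /\
    backtrack eta (x k) (xi k) (mu_start delta mu_low mu k) (mu k) (x k.+1).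

End problem.

(* Main.v *)
Require Import Defs.
From mathcomp Require Import all_boot all_order all_algebra.
From mathcomp Require Import all_classical all_reals all_analysis.
From mathcomp Require Import ring lra.
Import Order.TTheory GRing.Theory Num.Theory numFieldNormedType.Exports.

(** Write F x for the value of phi at the point (x, gvec g x) with x in X, so
    that H_mu (x, gvec g x) = mu/2 |x|^2 - F x.

    Decrease. The subgradients xi_i of - h_i are nonpositive, so the objective of the subproblem is the sum of a convex
    function and of mu/2 |. - x_k|^2. A minimizer of such a sum over a convex
    set satisfies the three-point inequality [proximal_three_point], with a gain
    of mu/2 |. - x_(k+1)|^2. Taken at x_k and added to the stopping test of the
    inner loop, which bounds H_mu at x_(k+1) from below by its linearization at
    x_k, it gives F x_k - F x_(k+1) >= mu_k/2 |x_(k+1) - x_k|^2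
    ([backtrack_decrease]). As mu_k >= mu_low > 0, the squared steps telescope
    into a finite sum as soon as F is bounded below.

    Boundedness of mu_k. The descent lemma says that mu/2 |.|^2 - f lies above
    its tangents when mu >= L and mu > 0; so (mu x - grad f x, xi) is a subgradient of H_mu
    ([H_mu_subgradient]) and the inner loop stops at any mu >= L. Hence
    mu_k <= max(mu_low, eta L) ([mu_le]).

    Limit points. Along an ultrafilter U refining the tail filter and for which
    (x_k, g x_k) tends to the given cluster point, every bounded real sequence
    converges, which replaces the extraction of successive subsequences. The
    limit has the form (xs, g xs) by continuity of g. The xi_k are bounded since
    the subgradients of a convex function are bounded near an interior point of
    its domain ([subgradient_lower_bound]), and their limit s is a subgradient
    at the limit ([subgradient_closed]). In the three-point inequality for
    x_(k+1) against a fixed y in X, the two quadratic terms in y have the same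
    limit, because x_k and x_(k+1) have the same limit and mu_k converges; they
    cancel, and xs minimizes the linearized objective over X. This says that
    (c xs - grad f xs, s) is a subgradient of G_c ([G_mu_subgradient]), and
    [H_mu_subgradient] shows that the same vector is a subgradient of H_c. *)

Set Implicit Arguments.
Unset Strict Implicit.
Unset Printing Implicit Defensive.

Local Open Scope classical_set_scope.
Local Open Scope ring_scope.

(** * Euclidean geometry and the descent lemma *)

Section euclidean.
Context {R : realType} {n : nat}.
Implicit Types u v w : 'rV[R]_n.

Lemma dotC u v : dot u v = dot v u.
Proof. by apply: eq_bigr => j _; rewrite mulrC. Qed.

Lemma dotDr u v w : dot u (v + w) = dot u v + dot u w.
Proof. by rewrite -big_split; apply: eq_bigr => j _; rewrite mxE mulrDr. Qed.

Lemma dotZr a u v : dot u (a *: v) = a * dot u v.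
Proof. by rewrite mulr_sumr; apply: eq_bigr => j _; rewrite mxE mulrCA. Qed.

Lemma dotNr u v : dot u (- v) = - dot u v.
Proof. by rewrite -scaleN1r dotZr mulN1r. Qed.

Lemma dotDl u v w : dot (v + w) u = dot v u + dot w u.
Proof. by rewrite dotC dotDr !(dotC u). Qed.

Lemma dotZl a u v : dot (a *: v) u = a * dot v u.
Proof. by rewrite dotC dotZr dotC. Qed.

Lemma dotNl u v : dot (- v) u = - dot v u.
Proof. by rewrite dotC dotNr dotC. Qed.

Definition dotE := (dotDr, dotDl, dotNr, dotNl, dotZr, dotZl).

Lemma dot_ge0 u : 0 <= dot u u.
Proof. by apply: sumr_ge0 => j _; rewrite -expr2 sqr_ge0. Qed.

Lemma enorm_sqr u : enorm u ^+ 2 = dot u u.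
Proof. by rewrite sqr_sqrtr ?dot_ge0. Qed.

Lemma enormB_sqr u v : enorm (u - v) ^+ 2 = dot u u - 2 * dot u v + dot v v.
Proof. by rewrite enorm_sqr !dotE (dotC v u); ring. Qed.

Lemma enormZ a u : enorm (a *: u) = `|a| * enorm u.
Proof. by rewrite /enorm dotZr dotZl mulrA -expr2 sqrtrM ?sqr_ge0// sqrtr_sqr. Qed.

(** The case of the Cauchy-Schwarz inequality used in the descent lemma; it
    only takes expanding |u - c v|^2 >= 0. *)
Lemma dot_le_of_enorm_le u v c :
  0 < c -> enorm u <= c * enorm v -> dot u v <= c * dot v v.
Proof.
move=> c0 uv.
have h1 : dot u u <= c ^+ 2 * dot v v.
  rewrite -!enorm_sqr -exprMn lerXn2r// nnegrE ?sqrtr_ge0//.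
  by rewrite mulr_ge0 ?sqrtr_ge0 ?ltW.
have := dot_ge0 (u - c *: v); rewrite !dotE (dotC v u) => h2.
have h3 : 0 <= (2 * c) * (c * dot v v - dot u v) by lra.
by rewrite -subr_ge0 -(pmulr_rge0 _ (_ : 0 < 2 * c))// mulr_gt0.
Qed.

(** The topology of row vectors is that of the sup norm, so this is what turns
    Euclidean estimates into convergence. *)
Lemma mx_norm_le_enorm u : `|u| <= enorm u.
Proof.
rewrite [leLHS]/Num.Def.normr/= mx_normrE (bigmax_le _ (sqrtr_ge0 _))//=.
move=> -[i j] _ /=; rewrite ord1 -sqrtr_sqr ler_wsqrtr// expr2 /dot (bigD1 j)//=.
by rewrite lerDl sumr_ge0// => k _; rewrite -expr2 sqr_ge0.
Qed.

Lemma dot_gradient (f : 'rV[R]_n -> R) x v :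
  differentiable f x -> dot (gradient f x) v = 'D_v f x.
Proof.
move=> df; rewrite deriveE// [in RHS](row_sum_delta v) linear_sum.
by apply: eq_bigr => j _; rewrite linearZ mxE deriveE// mulrC.
Qed.

Lemma derive_along_line (f : 'rV[R]_n -> R) (x v : 'rV[R]_n) (t : R) :
  differentiable f (x + t *: v) ->
  is_derive t 1 (fun s => f (x + s *: v)) (dot (gradient f (x + t *: v)) v).
Proof.
move=> df; have df1 : derivable f (x + t *: v) v by exact: diff_derivable.
have df2 := dot_gradient v df.
have E : (fun h : R => h^-1 *: (((fun s => f (x + s *: v)) \o shift t) (h *: 1)
    - f (x + t *: v))) =
  (fun h : R => h^-1 *: ((f \o shift (x + t *: v)) (h *: v) - f (x + t *: v))).
  apply/funext => h /=; congr (_ *: (f _ - _)).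
  by rewrite [h%:A]mulr1 scalerDl addrCA.
by split; rewrite ?df2 /derivable /derive E.
Qed.

(** The mean value theorem applies on [0, 1] to the gap
    F t = f (x + t d) - t <grad f x, d> - c/2 t^2 |d|^2, whose derivative
    <grad f (x + t d) - grad f x, d> - c t |d|^2 is nonpositive for t > 0 by the
    Lipschitz bound. *)
Lemma descent_lemma (f : 'rV[R]_n -> R) (c : R) :
  0 < c -> (forall x, differentiable f x) ->
  (forall x y, enorm (gradient f x - gradient f y) <= c * enorm (x - y)) ->
  forall x y, f y <= f x + dot (gradient f x) (y - x) + c / 2 * enorm (y - x) ^+ 2.
Proof.
move=> c0 df lip x y; set d := y - x.
pose F (t : R) := f (x + t *: d) - t * dot (gradient f x) d - c / 2 * t ^+ 2 * dot d d.
pose dF (t : R) :=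
  dot (gradient f (x + t *: d)) d - dot (gradient f x) d - c * t * dot d d.
have dFE t : is_derive t (1 : R) F (dF t).
  rewrite /F; have ? := derive_along_line (df (x + t *: d)).
  apply: is_derive_eq.
  by rewrite /dF /GRing.scale/=; field.
have [|t t01] := @MVT R F dF 0 1 ltr01 (fun t _ => dFE t).
  apply: continuous_subspaceT => t.
  by apply/differentiable_continuous/derivable1_diffP; have [] := dFE t.
have t0 : 0 < t by move: t01; rewrite in_itv/= => /andP[].
have : dot (gradient f (x + t *: d) - gradient f x) d <= (c * t) * dot d d.
  apply: dot_le_of_enorm_le; first by rewrite mulr_gt0.
  by apply: le_trans (lip _ _) _; rewrite addrC addKr enormZ gtr0_norm// mulrA.
rewrite dotDl dotNl enorm_sqr /F /dF scale1r scale0r addr0 (addrC x (y - x)) subrK.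
rewrite expr0n/= expr1n.
lra.
Qed.

End euclidean.

(** * Convexity and the proximal three-point inequality *)

Section convexity.
Context {R : realType}.

Lemma convex_function_segment (E : lmodType R) (A : set E) (F : E -> R) :
  convex_function A F ->
  forall a b t, A a -> A b -> 0 <= t <= 1 ->
    F (b + t *: (a - b)) <= F b + t * (F a - F b).
Proof.
move=> cF a b t Aa Ab /andP[t0 t1].
have := cF (Itv01 t0 t1) a b (mem_set Aa) (mem_set Ab).
rewrite convRE /= /conv/= scalerBl scale1r addrCA -scalerBr.
rewrite /unstable.onem => /le_trans; apply.
by rewrite le_eqVlt; apply/orP; left; apply/eqP; ring.
Qed.

Lemma convex_set_segment (E : lmodType R) (A : set E) :
  convex_set A ->
  forall a b t, A a -> A b -> 0 <= t <= 1 -> A (b + t *: (a - b)).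
Proof.
move=> cA a b t Aa Ab /andP[t0 t1].
have := cA a b (Itv01 t0 t1) (mem_set Aa) (mem_set Ab).
by rewrite /conv/= scalerBl scale1r addrCA -scalerBr => /set_mem.
Qed.

Lemma ge0_of_perturbation (A B : R) :
  (forall t, 0 < t -> t <= 1 -> 0 <= A + t * B) -> 0 <= A.
Proof.
move=> AB; rewrite leNgt; apply/negP => A0.
(* If A < 0, then t = - A / (|B| - A) lies in ]0, 1] and t |B| < - A. *)
have s0 : 0 < `|B| - A by rewrite subr_gt0 (lt_le_trans A0).
have := AB (- A / (`|B| - A)).
rewrite divr_gt0 ?oppr_gt0// ler_pdivrMr// mul1r lerDr normr_ge0.
move=> /(_ isT isT); rewrite -(pmulr_lge0 _ s0) mulrDl mulrAC divfK ?gt_eqF//.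
rewrite (_ : _ + _ = A * (`|B| - A - B)); last by ring.
by rewrite nmulr_rge0// leNgt subr_gt0 ltrBrDr -ltrBrDl; have := ler_norm B; lra.
Qed.

(** Moving from the minimizer y towards z changes the objective by
    t (mu <y - x, z - y> + c z - c y) + O(t^2) at most; minimality makes the
    first-order coefficient nonnegative, and the law of cosines for the triangle
    x, y, z turns this into the claim. *)
Lemma proximal_three_point n (X : set 'rV[R]_n) (c : 'rV[R]_n -> R) mu x y :
  convex_set X ->
  (forall a b t, 0 <= t <= 1 -> c (b + t *: (a - b)) <= c b + t * (c a - c b)) ->
  is_minimizer X (fun z => mu / 2 * enorm (z - x) ^+ 2 + c z) y ->
  forall z, X z ->
    mu / 2 * enorm (y - x) ^+ 2 + c y + mu / 2 * enorm (z - y) ^+ 2 <=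
    mu / 2 * enorm (z - x) ^+ 2 + c z.
Proof.
move=> cX cc [Xy miny] z Xz.
have : 0 <= mu * dot (y - x) (z - y) + (c z - c y).
  apply: (@ge0_of_perturbation _ (mu / 2 * dot (z - y) (z - y))) => t t0 t1.
  have t01 : 0 <= t <= 1 by rewrite (ltW t0).
  have := miny _ (convex_set_segment cX Xz Xy t01).
  have := cc z y t t01; rewrite addrAC !enorm_sqr.
  rewrite (dotDr _ (y - x) (t *: _)) (dotDl _ (y - x) (t *: _)) !dotZr.
  rewrite (dotDl _ (y - x) (t *: _)) !dotZl (dotC (z - y) (y - x)) => h1 h2.
  by rewrite -(pmulr_rge0 _ t0); lra.
rewrite !enorm_sqr (_ : z - x = (y - x) + (z - y)); last by rewrite [in RHS]addrC subrKA.
rewrite (dotDr _ (y - x) (z - y)) !(dotDl _ (y - x) (z - y)) (dotC (z - y) (y - x)).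
lra.
Qed.

End convexity.

(** * The two convex pieces of the objective *)

Section problem.
Context {R : realType} {m : nat} {n_ : 'I_m -> nat}.
Local Notation n := (\sum_(i < m) n_ i)%N.
Context (X : set 'rV[R]_n) (f : 'rV[R]_n -> R).
Context (g : forall i : 'I_m, 'rV[R]_(n_ i) -> R).
Context (D : 'I_m -> set R) (h : 'I_m -> R -> R).
Arguments g {i} _.
Hypothesis D_g : forall i x, X x -> D i (g (submxrow x i)).

Definition feasible_value (x : 'rV[R]_n) : R :=
  f x + \sum_(i < m) h i (g (submxrow x i)).

Lemma phi_gvec x : X x -> phi X f (@g) h (x, gvec (@g) x) = (feasible_value x)%:E.
Proof.
move=> Xx; rewrite /phi /chi /extend_pinfty mem_set ?add0e/=.
  by congr (_ + _)%:E; apply: eq_bigr => i _; rewrite mxE.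
by split=> // i; rewrite mxE.
Qed.

Lemma neg_hE i t : D i t -> neg_h D h i t = (- h i t)%:E.
Proof. by move=> Dt; rewrite /neg_h /extend_pinfty mem_set. Qed.

Lemma subdiff_neg_hP i t s : subdiff_neg_h D h i t s <->
  D i t /\ forall q, D i q -> - h i t + s * (q - t) <= - h i q.
Proof.
rewrite /subdiff_neg_h /subdiff /=; split=> [[tfin sub]|[Dt sub]].
  have Dt : D i t.
    apply: contrapT => nDt; move: tfin.
    by rewrite /neg_h /extend_pinfty memNset.
  split=> // q Dq; have := sub q.
  by rewrite !neg_hE// -EFinD lee_fin.
split=> [|q]; first by rewrite neg_hE.
rewrite (neg_hE Dt); have [Dq|nDq] := pselect (D i q).
  by rewrite neg_hE// -EFinD lee_fin sub.
by rewrite /neg_h /extend_pinfty memNset// leey.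
Qed.

Lemma H_muE mu x (z : 'rV[R]_m) : (forall i, D i (z 0 i)) ->
  H_mu f D h mu (x, z) =
  (mu / 2 * enorm x ^+ 2 - f x - \sum_(i < m) h i (z 0 i))%:E.
Proof.
move=> Dz; rewrite /H_mu/= (eq_bigr (fun i => (- h i (z 0 i))%:E)).
  by rewrite sumEFin sumrN -EFinD.
by move=> i _; rewrite neg_hE.
Qed.

Lemma H_mu_gvec mu x : X x ->
  H_mu f D h mu (x, gvec (@g) x) =
  (mu / 2 * enorm x ^+ 2 - feasible_value x)%:E.
Proof.
move=> Xx; rewrite H_muE; last by move=> i; rewrite mxE; exact: D_g.
rewrite /feasible_value opprD addrA; congr (_ - _)%:E.
by apply: eq_bigr => i _; rewrite mxE.
Qed.

(** In the x-variable the inequality is the descent lemma with constant mu, in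
    each z_i it is the definition of s_i; off the product of the D i the value
    of H_mu is +oo. *)
Lemma H_mu_subgradient (L mu : R) (x : 'rV[R]_n) (z s : 'rV[R]_m) :
  (forall x, differentiable f x) ->
  (forall x y, enorm (gradient f x - gradient f y) <= L * enorm (x - y)) ->
  0 < mu -> L <= mu ->
  (forall i, subdiff_neg_h D h i (z 0 i) (s 0 i)) ->
  subdiff (@dot_pair R n m) (H_mu f D h mu) (x, z)
    (mu *: x - gradient f x, s).
Proof.
move=> f_diff f_lip mu0 Lmu sz.
have Dz i : D i (z 0 i) by have /subdiff_neg_hP[] := sz i.
split=> [|[y w]]; first by rewrite H_muE.
have [Dw|] := pselect (forall i, D i (w 0 i)); last first.
  move=> /existsNP[i nDw]; suff -> : H_mu f D h mu (y, w) = +oo%E by rewrite leey.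
  rewrite /H_mu/=; suff -> : (\sum_(i < m) neg_h D h i (w 0%R i) = +oo)%E by [].
  apply/esum_eqyP => [j _|]; first by rewrite /neg_h /extend_pinfty; case: ifP.
  by exists i; split=> //; rewrite /neg_h /extend_pinfty memNset.
rewrite !H_muE// -EFinD lee_fin /dot_pair/=.
have f_lip' a b : enorm (gradient f a - gradient f b) <= mu * enorm (a - b).
  by rewrite (le_trans (f_lip _ _))// ler_wpM2r// sqrtr_ge0.
have := descent_lemma mu0 f_diff f_lip' x y.
have : dot s (w - z) <= \sum_(i < m) (h i (z 0 i) - h i (w 0 i)).
  apply: ler_sum => i _; have /subdiff_neg_hP[_ /(_ _ (Dw i))] := sz i.
  by rewrite !mxE; lra.
rewrite sumrB enormB_sqr !enorm_sqr !dotE (dotC y x); lra.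
Qed.

End problem.

(** * One iteration of the algorithm *)

Section iteration.
Context {R : realType} {m : nat} {n_ : 'I_m -> nat}.
Local Notation n := (\sum_(i < m) n_ i)%N.
Context (X : set 'rV[R]_n) (f : 'rV[R]_n -> R) (L : R).
Context (g : forall i : 'I_m, 'rV[R]_(n_ i) -> R).
Context (D : 'I_m -> set R) (h : 'I_m -> R -> R).
Arguments g {i} _.
Hypothesis D_g : forall i x, X x -> D i (g (submxrow x i)).
Hypothesis X_convex : convex_set X.
Hypothesis g_convex : forall i, convex_function setT (@g i).
Hypothesis f_diff : forall x, differentiable f x.
Hypothesis f_lip : forall x y,
  enorm (gradient f x - gradient f y) <= L * enorm (x - y).
Hypothesis h_subdiff : forall i x (t : R), X x -> g (submxrow x i) <= t ->
  subdiff_neg_h D h i t `<=` [set s | s <= 0].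

(** The objective of the subproblem without its proximal term. *)
Definition linearized (x : 'rV[R]_n) (xi : 'rV[R]_m) (y : 'rV[R]_n) : R :=
  dot (gradient f x) y + \sum_(i < m) - xi 0 i * g (submxrow y i).

Lemma linearized_convex (x : 'rV[R]_n) (xi : 'rV[R]_m) : (forall i, xi 0 i <= 0) ->
  forall a b t, 0 <= t <= 1 ->
  linearized x xi (b + t *: (a - b)) <=
  linearized x xi b + t * (linearized x xi a - linearized x xi b).
Proof.
move=> xi0 a b t t01; rewrite /linearized.
have : \sum_(i < m) - xi 0 i * g (submxrow (b + t *: (a - b)) i) <=
    \sum_(i < m) - xi 0 i * g (submxrow b i) +
    t * (\sum_(i < m) - xi 0 i * g (submxrow a i)
         - \sum_(i < m) - xi 0 i * g (submxrow b i)).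
  rewrite -sumrB mulr_sumr -big_split/=; apply: ler_sum => i _.
  rewrite -mulrBr mulrCA -mulrDr ler_wpM2l ?oppr_ge0//.
  have -> : submxrow (b + t *: (a - b)) i =
      submxrow b i + t *: (submxrow a i - submxrow b i).
    by apply/matrixP => j k; rewrite !mxE.
  exact: (convex_function_segment (@g_convex i) I I t01).
by rewrite dotDr dotZr dotDr dotNr; lra.
Qed.

Section step.
Context (eta : R) (x : 'rV[R]_n) (xi : 'rV[R]_m) (mu0 mu : R) (y : 'rV[R]_n).
Hypothesis Xx : X x.
Hypothesis xi_sub : forall i, subdiff_neg_h D h i (g (submxrow x i)) (xi 0 i).
Hypothesis xy : backtrack X f (@g) D h eta x xi mu0 mu y.

Lemma xi_le0 i : xi 0 i <= 0.
Proof. exact: h_subdiff Xx (lexx _) _ (xi_sub i). Qed.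

Lemma backtrack_final :
  is_minimizer X (subproblem f (@g) mu x xi) y /\
  ~ must_increase f (@g) D h mu x xi y.
Proof. by elim: xy. Qed.

Lemma backtrack_point : X y.
Proof. by case: backtrack_final => -[]. Qed.

Lemma backtrack_ge : 1 < eta -> 0 < mu0 -> mu0 <= mu.
Proof.
move=> eta1; elim: xy => // mu1 y1 mu' y' _ _ _ IH mu_gt0.
apply: le_trans (IH _); last by rewrite mulr_gt0// (lt_trans ltr01).
by rewrite ler_peMl// ltW.
Qed.

(** The loop condition says that H_c lies strictly below its linearization at
    (x, gvec g x), which [H_mu_subgradient] excludes when L <= c. *)
Lemma must_increase_lt (c : R) (z : 'rV[R]_n) : 0 < c -> X z ->
  must_increase f (@g) D h c x xi z -> c < L.
Proof.
move=> c0 Xz; rewrite ltNge; apply: contraPN => Lc.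
have [|_ /(_ (z, gvec (@g) z)) sub] :=
  @H_mu_subgradient _ _ _ f D h L c x (gvec (@g) x) xi f_diff f_lip c0 Lc.
  by move=> i; rewrite mxE; exact: xi_sub.
by rewrite /must_increase ltNge => /negP; apply; exact: sub.
Qed.

(** Each increase starts from a parameter smaller than L and multiplies it by
    eta. *)
Lemma backtrack_le (M : R) : 1 < eta -> 0 < mu0 -> mu0 <= M -> eta * L <= M ->
  mu <= M.
Proof.
move=> eta1 + + etaL; have eta0 : 0 < eta := lt_trans ltr01 eta1.
elim: xy => // mu1 y1 mu' y' [Xy _] inc _ IH mu_gt0 _; apply: IH.
  by rewrite mulr_gt0.
by rewrite (le_trans _ etaL)// ler_wpM2l// ltW//; exact: must_increase_lt inc.
Qed.

Lemma backtrack_three_point z : X z ->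
  mu / 2 * enorm (y - x) ^+ 2 + linearized x xi y + mu / 2 * enorm (z - y) ^+ 2
  <= mu / 2 * enorm (z - x) ^+ 2 + linearized x xi z.
Proof.
apply: proximal_three_point => //.
  by move=> a b t; apply: linearized_convex => i; exact: xi_le0.
have [[Xy ymin] _] := backtrack_final; split=> // w Xw.
by rewrite !addrA; exact: ymin.
Qed.

(** With d = y - x, the three-point inequality at x gives mu |d|^2 of decrease in
    the linearized objective, and the stopping test loses at most mu/2 |d|^2 when
    passing from the linearized objective to the true one. *)
Lemma backtrack_decrease :
  mu / 2 * enorm (y - x) ^+ 2 <= feasible_value f (@g) h x - feasible_value f (@g) h y.
Proof.
have [_] := backtrack_final; have Xy := backtrack_point.
rewrite /must_increase !(H_mu_gvec _ _ D_g)// -EFinD lte_fin => /negP; rewrite -leNgt.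
have := backtrack_three_point Xx; rewrite /linearized !enormB_sqr !enorm_sqr.
have -> : dot xi (gvec (@g) y - gvec (@g) x) =
    \sum_(i < m) - xi 0 i * g (submxrow x i) - \sum_(i < m) - xi 0 i * g (submxrow y i).
  by rewrite -sumrB; apply: eq_bigr => i _; rewrite !mxE; ring.
rewrite !dotE (dotC y x).
lra.
Qed.

End step.
End iteration.

(** * Convergence along ultrafilters *)

(** The intersections of a member of F with the preimage of a neighborhood of p
    generate a filter, proper precisely because p is a cluster point; any
    ultrafilter above it works. *)
Lemma cluster_ultrafilter (I : Type) (T : topologicalType) (F : set_system I)
    (u : I -> T) p {FF : ProperFilter F} :
  cluster (u @ F) p ->
  exists U : set_system I, [/\ UltraFilter U, F `<=` U & u @ U --> p].
Proof.
move=> clp.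
pose B (AC : set I * set T) := AC.1 `&` u @^-1` AC.2.
pose G := filter_from [set AC : set I * set T | F AC.1 /\ nbhs p AC.2] B.
have GF : ProperFilter G.
  apply: filter_from_proper.
    apply: filter_from_filter.
      by exists (setT, setT); split; exact: filterT.
    move=> [A1 C1] [A2 C2] [/= FA1 pC1] [/= FA2 pC2].
    exists (A1 `&` A2, C1 `&` C2); first by split; exact: filterI.
    by move=> k [/= [? ?] [? ?]].
  move=> [A C] [/= FA pC].
  have FuA : F (u @^-1` (u @` A)) by apply: filterS FA => k Ak; exists k.
  by have [_ [[k Ak <-] Cuk]] := clp _ _ FuA pC; exists k.
have [U [UU GU]] := ultraFilterLemma GF.
exists U; split=> // [A FA|C pC]; apply: GU.
  by exists (A, setT); [split=> //; exact: filterT|move=> k []].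
by exists (setT, C); [split=> //; exact: filterT|move=> k []].
Qed.

(** Bolzano-Weierstrass for ultrafilters: a cluster point is already a limit. *)
Lemma ultra_bounded_cvg (R : realType) (I : Type) (U : set_system I)
    (u : I -> R) lo hi {UU : UltraFilter U} :
  (\forall k \near U, lo <= u k <= hi) ->
  exists l : R, u @ U --> l.
Proof.
move=> bnd.
have [l [_ cl]] : `[lo, hi]%classic `&` cluster (u @ U) !=set0.
  by apply: segment_compact; apply: filterS bnd => k; rewrite /= in_itv.
exists l => C lC; have [//|UC] := in_ultra_setVsetC (u @^-1` C) UU.
by have [t []] := cl (~` C) C UC lC.
Qed.

Lemma submxrow_continuous (R : realType) (m : nat) (n_ : 'I_m -> nat) (i : 'I_m) :
  continuous (fun x : 'rV[R]_(\sum_(j < m) n_ j) => submxrow x i).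
Proof.
move=> x A /nbhs_ballP[e e0 eA]; apply/nbhs_ballP; exists e => // y [_ xy].
by apply: eA; split=> // j k; rewrite !mxE; exact: xy.
Qed.

Lemma cvg_coord (R : realType) (I : Type) (U : set_system I) n
    (u : I -> 'rV[R]_n) (a : 'rV[R]_n) j {UF : Filter U} :
  u @ U --> a -> u k 0 j @[k --> U] --> a 0 j.
Proof.
move=> ua.
apply: (@continuous_cvg _ _ _ U UF u (fun M : 'rV[R]_n => M 0 j) a _ ua).
exact: coord_continuous.
Qed.

Lemma cvg_sumr (R : realType) (I : Type) (U : set_system I) n
    (u : 'I_n -> I -> R) (a : 'I_n -> R) {UF : Filter U} :
  (forall j, u j @ U --> a j) ->
  \sum_(j < n) u j k @[k --> U] --> \sum_(j < n) a j.
Proof. by move=> ua; apply: cvg_big => //; exact: add_continuous. Qed.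

Lemma cvg_dot (R : realType) (I : Type) (U : set_system I) n
    (u v : I -> 'rV[R]_n) (a b : 'rV[R]_n) {UF : Filter U} :
  u @ U --> a -> v @ U --> b ->
  dot (u k) (v k) @[k --> U] --> dot a b.
Proof. by move=> ua vb; apply: cvg_sumr => j; apply: cvgM; exact: cvg_coord. Qed.

Lemma cvg_enorm_sqr (R : realType) (I : Type) (U : set_system I) n
    (u : I -> 'rV[R]_n) (a : 'rV[R]_n) {UF : Filter U} :
  u @ U --> a ->
  enorm (u k) ^+ 2 @[k --> U] --> enorm a ^+ 2.
Proof.
move=> ua; rewrite enorm_sqr (eq_cvg _ _ (fun k => enorm_sqr (u k))).
exact: cvg_dot.
Qed.

Lemma cvg_of_enorm_sub (R : realType) (I : Type) (U : set_system I) n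
    (u v : I -> 'rV[R]_n) (a : 'rV[R]_n) {UF : Filter U} :
  u @ U --> a ->
  enorm (v k - u k) @[k --> U] --> (0 : R) -> v @ U --> a.
Proof.
move=> ua uv; rewrite -(addr0 a) (_ : v = u + (v - u)); last by rewrite addrC subrK.
apply: cvgD => //; apply: norm_cvg0; apply: (squeeze_cvgr _ (cvg_cst 0) uv).
by apply: nearW => k; rewrite normr_ge0 mx_norm_le_enorm.
Qed.

(** * Subgradients of - h for h concave on an open set *)

Section concave.
Context {R : realType} {m : nat}.
Variables (D : 'I_m -> set R) (h : 'I_m -> R -> R) (i : 'I_m).
Hypothesis D_open : open (D i).
Hypothesis h_concave : convex_function (D i) (fun t => - h i t).
Hypothesis h_nondecr : forall s t, D i s -> D i t -> s <= t -> h i s <= h i t.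

(** To the left of z this is monotonicity; to the right of z, the graph of h_i
    lies below the prolonged chord through a and z. The bound gives both the
    local boundedness of the slopes and the upper semicontinuity at z. *)
Lemma concave_upper_bound a z t : D i a -> D i z -> D i t -> a < z ->
  h i t <= h i z + (h i z - h i a) / (z - a) * `|t - z|.
Proof.
move=> Da Dz Dt az; have za : 0 < z - a by rewrite subr_gt0.
have haz : h i a <= h i z by rewrite h_nondecr// ltW.
have [tz|zt] := leP t z.
  by rewrite -[leLHS]addr0 lerD ?h_nondecr// mulr_ge0// divr_ge0 ?subr_ge0// ltW.
have ta : 0 < t - a by rewrite subr_gt0 (lt_trans az).
pose l := (z - a) / (t - a).
have l01 : 0 <= l <= 1.
  by rewrite divr_ge0 ?(ltW za) ?(ltW ta)//= ler_pdivrMr// mul1r lerD2r ltW.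
have := convex_function_segment h_concave Dt Da l01.
have lE : l * (t - a) = z - a by rewrite /l divfK ?gt_eqF.
have -> : a + l *: (t - a) = z by rewrite /GRing.scale/= lE addrC subrK.
move=> h1.
rewrite gtr0_norm ?subr_gt0// -lerBlDl mulrAC ler_pdivlMr//.
have := ler_wpM2r (ltW ta) h1; rewrite mulrDl (mulrAC l) lE.
lra.
Qed.

Lemma exists_left_point z : D i z -> exists2 a, D i a & a < z.
Proof.
move=> Dz; have /nbhs_ballP[e /= e0 eD] := open_nbhs_nbhs (conj D_open Dz).
exists (z - e / 2); last by rewrite ltrBlDr ltrDl divr_gt0.
by apply: eD; rewrite /ball/= opprB addrC subrK gtr0_norm ?divr_gt0// ltr_pdivrMr//; lra.
Qed.

Section limit.
Context (I : Type) (U : set_system I) (z s : I -> R) (z0 : R).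
Hypothesis zz0 : z @ U --> z0.
Hypothesis Dz0 : D i z0.
Hypothesis sz : forall k, subdiff_neg_h D h i (z k) (s k).

(** Fix a < z0 in D i. The subgradient inequality at a bounds - s k * (z k - a)
    by h (z k) - h a, which stays bounded near z0 while z k - a stays away
    from 0. *)
Lemma subgradient_lower_bound {UF : Filter U} : (forall k, s k <= 0) ->
  exists lo, \forall k \near U, lo <= s k.
Proof.
move=> s_le0; have [a Da az] := exists_left_point Dz0.
have az0 : 0 < z0 - a by rewrite subr_gt0.
have c0 : 0 < (z0 - a) / 2 by rewrite divr_gt0.
(* If |z k - z0| <= (z0 - a) / 2, then h (z k) - h a <= 3/2 (h z0 - h a) by
   [concave_upper_bound], while z k - a >= (z0 - a) / 2; the quotient is the
   constant below. *)
exists (- (3 * (h i z0 - h i a) / (z0 - a))).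
have := @cvgr_dist_le _ _ _ _ UF z z0 zz0 _ c0; apply: filterS => k zk.
have [Dzk /(_ _ Da)] := (subdiff_neg_hP _ _ _ _ _).1 (sz k).
have := concave_upper_bound Da Dz0 Dzk az; rewrite distrC.
have C0 : 0 <= (h i z0 - h i a) / (z0 - a).
  by rewrite divr_ge0 ?subr_ge0 ?h_nondecr// ltW.
have := ler_wpM2l C0 zk; rewrite mulrA divfK ?gt_eqF// => h1 h2 h3.
rewrite -subr_ge0 opprK -(pmulr_lge0 _ az0) mulrDl divfK ?gt_eqF//.
have zka : (z0 - a) / 2 <= z k - a.
  by have := ler_norm (z0 - z k); lra.
have : s k * (z k - a) <= s k * ((z0 - a) / 2) by rewrite ler_wnM2l.
lra.
Qed.

(** Passing to the limit in - h (z k) + s k (q - z k) <= - h q only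
    requires - h z0 <= liminf - h (z k), and this follows from
    [concave_upper_bound]. *)
Lemma subgradient_closed {UF : ProperFilter U} s0 : s @ U --> s0 ->
  subdiff_neg_h D h i z0 s0.
Proof.
move=> ss0; apply/subdiff_neg_hP; split=> // q Dq.
have [a Da az] := exists_left_point Dz0.
pose C := (h i z0 - h i a) / (z0 - a).
have lim : (- h i z0 - C * `|z k - z0| + s k * (q - z k)) @[k --> U] -->
    - h i z0 - C * `|z0 - z0| + s0 * (q - z0).
  apply: cvgD; last by apply: cvgM => //; apply: cvgB => //; exact: cvg_cst.
  apply: cvgB; first exact: cvg_cst.
  apply: cvgM; first exact: cvg_cst.
  by apply: cvg_norm; apply: cvgB => //; exact: cvg_cst.
have -> : - h i z0 + s0 * (q - z0) = - h i z0 - C * `|z0 - z0| + s0 * (q - z0).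
  by rewrite subrr normr0 mulr0 subr0.
rewrite -(cvg_lim (@norm_hausdorff _ _) lim).
apply: limr_le; first by apply/cvg_ex; eexists; exact: lim.
apply: nearW => k.
have [Dzk /(_ _ Dq)] := (subdiff_neg_hP _ _ _ _ _).1 (sz k).
by have := concave_upper_bound Da Dz0 Dzk az; rewrite -/C; lra.
Qed.

End limit.
End concave.

(** * Summability from a sufficient decrease *)

Section summability.
Context {R : realType}.
Variables (F u : nat -> R) (c a : R).
Hypotheses (c_gt0 : 0 < c) (u_ge0 : forall k, 0 <= u k).
Hypothesis decrease : forall k, c * u k <= F k - F k.+1.
Hypothesis F_ge : forall k, a <= F k.

Lemma partial_sums_le N : \sum_(0 <= k < N) u k <= (F 0%N - a) / c.
Proof.
rewrite ler_pdivlMr// mulrC mulr_sumr.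
apply: (@le_trans _ _ (\sum_(0 <= k < N) (F k - F k.+1))); first exact: ler_sum.
by rewrite -[leLHS]opprK -sumrN; under eq_bigr do rewrite opprB;
  rewrite telescope_sumr//; have := F_ge N; lra.
Qed.

Lemma summable_lt_pinfty : (\sum_(0 <= k <oo) (u k)%:E < +oo)%E.
Proof.
apply: (@le_lt_trans _ _ ((F 0%N - a) / c)%:E); last exact: ltry.
apply: lime_le; first by apply: is_cvg_nneseries => k _ _; rewrite lee_fin.
by apply: nearW => N; rewrite sumEFin lee_fin partial_sums_le.
Qed.

Lemma summable_cvg0 : u k @[k --> \oo] --> 0.
Proof.
exact: cvg_series_cvg_0 (nnseries_is_cvg u_ge0 summable_lt_pinfty).
Qed.

End summability.

(** * Optimality in the linearized problem *)

Section optimality.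
Context {R : realType} {m : nat} {n_ : 'I_m -> nat}.
Local Notation n := (\sum_(i < m) n_ i)%N.
Context (X : set 'rV[R]_n) (f : 'rV[R]_n -> R).
Context (g : forall i : 'I_m, 'rV[R]_(n_ i) -> R).
Arguments g {i} _.
Hypothesis f_C1 : continuous (gradient f).
Hypothesis g_cont : forall i, continuous (@g i).

(** On Omega, mu/2 |y|^2 lies above its tangent at x, and as s <= 0 one has
    s_i w_i <= s_i g_i (y_i); the remaining terms compare the linearized
    objective at x and y. *)
Lemma G_mu_subgradient mu (x : 'rV[R]_n) (s : 'rV[R]_m) : 0 <= mu -> X x ->
  (forall i, s 0 i <= 0) ->
  (forall y, X y -> linearized f (@g) x s x <= linearized f (@g) x s y) ->
  subdiff (@dot_pair R n m) (G_mu X (@g) mu) (x, gvec (@g) x)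
    (mu *: x - gradient f x, s).
Proof.
move=> mu0 Xx s0 xmin.
have G_muE p : Omega X (@g) p ->
    G_mu X (@g) mu p = (mu / 2 * enorm p.1 ^+ 2)%:E.
  by move=> Op; rewrite /G_mu /chi /extend_pinfty mem_set// adde0.
have Ox : Omega X (@g) (x, gvec (@g) x) by split=> // i; rewrite mxE.
rewrite /subdiff /=; split=> [|[y w]]; first by rewrite G_muE.
have [Ow|nOw] := pselect (Omega X (@g) (y, w)); last first.
  by rewrite [leRHS]/G_mu /chi /extend_pinfty memNset// addeC leey.
rewrite !G_muE// -EFinD lee_fin /dot_pair/=.
have [/= Xy gw] := Ow; have := xmin y Xy; rewrite /linearized => h1.
have h2 : dot s (w - gvec (@g) x) <=
    \sum_(i < m) - s 0 i * g (submxrow x i) - \sum_(i < m) - s 0 i * g (submxrow y i).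
  rewrite -sumrB; apply: ler_sum => i _; rewrite !mxE.
  have : s 0 i * w 0 i <= s 0 i * g (submxrow y i) by rewrite ler_wnM2l.
  lra.
have h3 : 0 <= mu / 2 * enorm (y - x) ^+ 2 by rewrite mulr_ge0 ?sqr_ge0 ?divr_ge0.
move: h1 h2 h3; rewrite enormB_sqr !enorm_sqr !dotE (dotC y x); lra.
Qed.

Lemma cvg_linearized (I : Type) (U : set_system I)
    (x y : I -> 'rV[R]_n) (xi : I -> 'rV[R]_m) (x0 y0 : 'rV[R]_n) (xi0 : 'rV[R]_m)
    {UF : Filter U} :
  x @ U --> x0 -> y @ U --> y0 ->
  (forall i, xi k 0 i @[k --> U] --> xi0 0 i) ->
  linearized f (@g) (x k) (xi k) (y k) @[k --> U] --> linearized f (@g) x0 xi0 y0.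
Proof.
move=> xx0 yy0 xixi0; apply: cvgD.
  by apply: cvg_dot => //; apply: continuous_cvg xx0; exact: f_C1.
apply: cvg_sumr => i; apply: cvgM; first by apply: cvgN; exact: xixi0.
apply: (@continuous_cvg _ _ _ U UF (fun k => submxrow (y k) i) g).
  exact: g_cont.
by apply: continuous_cvg yy0; exact: submxrow_continuous.
Qed.

End optimality.

(** * The sequence generated by the algorithm *)

Section sequence.
Context {R : realType} {m : nat} {n_ : 'I_m -> nat}.
Local Notation n := (\sum_(i < m) n_ i)%N.
Context (X : set 'rV[R]_n) (f : 'rV[R]_n -> R) (L : R).
Context (g : forall i : 'I_m, 'rV[R]_(n_ i) -> R).
Context (D : 'I_m -> set R) (h : 'I_m -> R -> R).
Arguments g {i} _.
Hypothesis D_g : forall i x, X x -> D i (g (submxrow x i)).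
Hypothesis X_convex : convex_set X.
Hypothesis g_convex : forall i, convex_function setT (@g i).
Hypothesis f_diff : forall x, differentiable f x.
Hypothesis f_lip : forall x y,
  enorm (gradient f x - gradient f y) <= L * enorm (x - y).
Hypothesis h_subdiff : forall i x (t : R), X x -> g (submxrow x i) <= t ->
  subdiff_neg_h D h i t `<=` [set s | s <= 0].
Context (eta delta mu_low : R).
Hypotheses (eta_gt1 : 1 < eta) (delta_lt1 : delta < 1).
Hypothesis mu_low_gt0 : 0 < mu_low.
Context (x : nat -> 'rV[R]_n) (xi : nat -> 'rV[R]_m) (mu : nat -> R).
Hypothesis x_dca : dca_like X f (@g) D h eta delta mu_low x xi mu.

Lemma dca_feasible k : X (x k).
Proof. by case: x_dca => X0; case: k => // k /(_ k)[_] /backtrack_point. Qed.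

Lemma dca_xi k i : subdiff_neg_h D h i (g (submxrow (x k) i)) (xi k 0 i).
Proof. by case: x_dca => _ /(_ k)[]. Qed.

Lemma dca_backtrack k :
  backtrack X f (@g) D h eta (x k) (xi k) (mu_start delta mu_low mu k) (mu k) (x k.+1).
Proof. by case: x_dca => _ /(_ k)[]. Qed.

Lemma mu_start_ge k : mu_low <= mu_start delta mu_low mu k.
Proof. by case: k => [|k] //=; rewrite le_max lexx. Qed.

Lemma mu_start_gt0 k : 0 < mu_start delta mu_low mu k.
Proof. exact: lt_le_trans (mu_start_ge k). Qed.

Lemma mu_ge k : mu_low <= mu k.
Proof.
exact: le_trans (mu_start_ge k) (backtrack_ge (dca_backtrack k) eta_gt1 (mu_start_gt0 k)).
Qed.

(** The restart max(mu_low, delta mu_(k-1)) never exceeds the bound since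
    delta < 1. *)
Lemma mu_le k : mu k <= Num.max mu_low (eta * L).
Proof.
have le_k k' := backtrack_le f_diff f_lip (@dca_xi k')
  (dca_backtrack k') eta_gt1 (mu_start_gt0 k').
elim: k => [|k IH]; (apply: le_k; last by rewrite le_max lexx orbT).
  by rewrite le_max lexx.
rewrite ge_max le_max lexx /=; apply: le_trans IH.
by rewrite ger_pMl ?(lt_le_trans mu_low_gt0 (mu_ge k))// ltW.
Qed.

Lemma dca_decrease k : mu k / 2 * enorm (x k.+1 - x k) ^+ 2 <=
  feasible_value f (@g) h (x k) - feasible_value f (@g) h (x k.+1).
Proof.
exact: (backtrack_decrease D_g X_convex g_convex h_subdiff (@dca_feasible _) (@dca_xi _)
  (dca_backtrack _)).
Qed.

Lemma dca_uniform_decrease k : mu_low / 2 * enorm (x k.+1 - x k) ^+ 2 <=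
  feasible_value f (@g) h (x k) - feasible_value f (@g) h (x k.+1).
Proof.
apply: le_trans (dca_decrease k).
by rewrite ler_wpM2r ?sqr_ge0// ler_pM2r ?invr_gt0// mu_ge.
Qed.

Lemma feasible_value_lower_bound :
  (-oo < ereal_inf (range (phi X f (@g) h)))%E ->
  exists a, forall k, a <= feasible_value f (@g) h (x k).
Proof.
move=> inf_gt.
have inf_le k :
    (ereal_inf (range (phi X f (@g) h)) <= (feasible_value f (@g) h (x k))%:E)%E.
  apply: ge_ereal_inf; exists (feasible_value f (@g) h (x k))%:E => //.
  by exists (x k, gvec (@g) (x k)) => //; rewrite phi_gvec//; exact: dca_feasible.
case: ereal_inf inf_gt inf_le => [a _ al|_ /(_ 0%N)|//].
  by exists a => k; have := al k; rewrite lee_fin.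
by rewrite leye_eq.
Qed.

Lemma dca_steps_summable : (-oo < ereal_inf (range (phi X f (@g) h)))%E ->
  (\sum_(0 <= k <oo) (enorm (x k.+1 - x k) ^+ 2)%:E < +oo)%E.
Proof.
move=> /feasible_value_lower_bound[a aF].
have mu2 : 0 < mu_low / 2 by rewrite divr_gt0.
by apply: (summable_lt_pinfty mu2 _ dca_uniform_decrease aF) => k; rewrite sqr_ge0.
Qed.

Lemma dca_steps_cvg0 : (-oo < ereal_inf (range (phi X f (@g) h)))%E ->
  enorm (x k.+1 - x k) @[k --> \oo] --> (0 : R).
Proof.
move=> /feasible_value_lower_bound[a aF].
have mu2 : 0 < mu_low / 2 by rewrite divr_gt0.
have sq0 : (enorm (x k.+1 - x k) ^+ 2) @[k --> \oo] --> (0 : R).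
  by apply: (summable_cvg0 mu2 _ dca_uniform_decrease aF) => k; rewrite sqr_ge0.
have -> : (fun k => enorm (x k.+1 - x k)) =
    Num.sqrt \o (fun k => enorm (x k.+1 - x k) ^+ 2).
  by apply/funext => k /=; rewrite sqrtr_sqr ger0_norm ?sqrtr_ge0.
by rewrite -[X in _ --> X](@sqrtr0 R); apply: continuous_cvg sq0; exact: sqrt_continuous.
Qed.

Hypothesis X_closed : closed X.
Hypothesis f_C1 : continuous (gradient f).
Hypothesis g_cont : forall i, continuous (@g i).
Hypothesis D_open : forall i, open (D i).
Hypothesis h_concave : forall i, convex_function (D i) (fun t => - h i t).
Hypothesis h_nondecr : forall i s t, D i s -> D i t -> s <= t -> h i s <= h i t.

Lemma limit_point_critical (p : 'rV[R]_n * 'rV[R]_m) :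
  (-oo < ereal_inf (range (phi X f (@g) h)))%E ->
  cluster ((fun k => (x k, gvec (@g) (x k))) @ \oo) p ->
  critical_point X f (@g) D h L p.
Proof.
move=> phi_bounded; case: p => xs zs cl.
have [U [UU ooU xzU]] : exists U : set_system nat,
    [/\ UltraFilter U, \oo `<=` U & (x k, gvec (@g) (x k)) @[k --> U] --> (xs, zs)].
  exact: cluster_ultrafilter cl.
have UF : ProperFilter U by exact: @ultra_proper _ _ UU.
have xU : x @ U --> xs.
  by apply: (@continuous_cvg _ _ _ U _ _ fst _ _ xzU); exact: cvg_fst.
have zU : (fun k => gvec (@g) (x k)) @ U --> zs.
  by apply: (@continuous_cvg _ _ _ U _ _ snd _ _ xzU); exact: cvg_snd.
have Xxs : X xs.
  by apply: (closed_cvg _ X_closed _ _ xU); apply: nearW => k; exact: dca_feasible.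
have gU i : g (submxrow (x k) i) @[k --> U] --> g (submxrow xs i).
  apply: (@continuous_cvg _ _ _ U _ (fun k => submxrow (x k) i) g).
    exact: g_cont.
  by apply: continuous_cvg xU; exact: submxrow_continuous.
(* The graph of the continuous map x |-> gvec g x is closed. *)
have -> : zs = gvec (@g) xs.
  apply/rowP => i; rewrite [RHS]mxE.
  have gvec_i k : gvec (@g) (x k) 0 i = g (submxrow (x k) i) by rewrite mxE.
  apply: cvg_unique (gU i); first exact: norm_hausdorff.
  by rewrite /= -(eq_cvg _ _ gvec_i); exact: cvg_coord zU.
have xi0 k i : xi k 0 i <= 0.
  by apply: (xi_le0 h_subdiff (dca_feasible k)) => j; exact: dca_xi.
have xiU i : exists s : R, xi k 0 i @[k --> U] --> s.
  have [lo loP] := subgradient_lower_bound (@D_open i) (@h_concave i) (@h_nondecr i)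
    (gU i) (D_g i Xxs) (fun k => dca_xi k i) (fun k => xi0 k i).
  apply: (@ultra_bounded_cvg _ _ _ _ lo 0); apply: filterS loP => k ->.
  exact: xi0.
have {xiU} [s0 sU] : exists s : 'rV[R]_m, forall i, xi k 0 i @[k --> U] --> s 0 i.
  have [s sU] := choice xiU.
  by exists (\row_i s i) => i; rewrite mxE.
have s_sub i : subdiff_neg_h D h i (gvec (@g) xs 0 i) (s0 0 i).
  rewrite mxE.
  apply: (subgradient_closed (@D_open i) (@h_concave i) (@h_nondecr i) (gU i)
    (D_g i Xxs) _ (sU i)) => k.
  exact: dca_xi.
have [mus muU] : exists l : R, mu @ U --> l.
  apply: (@ultra_bounded_cvg _ _ _ _ mu_low (Num.max mu_low (eta * L))).
  by apply: nearW => k; rewrite mu_ge//= mu_le.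
have xSU : (fun k => x k.+1) @ U --> xs.
  apply: cvg_of_enorm_sub xU _.
  exact: cvg_trans (cvg_app _ ooU) (dca_steps_cvg0 phi_bounded).
move=> c c0 Lc; exists (c *: xs - gradient f xs, s0); split.
  exact: H_mu_subgradient.
apply: G_mu_subgradient => // [|i|y Xy]; first exact: ltW.
  by apply: (h_subdiff Xxs _ (s_sub i)); rewrite mxE.
(* Both sides of the three-point inequality tend along U to the linearized
   objective plus the same quadratic term, which then cancels. *)
have lhs : (linearized f (@g) (x k) (xi k) (x k.+1) +
    mu k / 2 * enorm (y - x k.+1) ^+ 2)
    @[k --> U] --> linearized f (@g) xs s0 xs + mus / 2 * enorm (y - xs) ^+ 2.
  apply: cvgD; first exact: cvg_linearized.
  apply: cvgM; first by apply: cvgM => //; exact: cvg_cst.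
  by apply: cvg_enorm_sqr; apply: cvgB => //; exact: cvg_cst.
have rhs : (linearized f (@g) (x k) (xi k) y + mu k / 2 * enorm (y - x k) ^+ 2)
    @[k --> U] --> linearized f (@g) xs s0 y + mus / 2 * enorm (y - xs) ^+ 2.
  apply: cvgD; first by apply: cvg_linearized => //; exact: cvg_cst.
  apply: cvgM; first by apply: cvgM => //; exact: cvg_cst.
  by apply: cvg_enorm_sqr; apply: cvgB => //; exact: cvg_cst.
rewrite -(lerD2r (mus / 2 * enorm (y - xs) ^+ 2)).
rewrite -(cvg_lim (@norm_hausdorff _ _) lhs) -(cvg_lim (@norm_hausdorff _ _) rhs).
apply: ler_lim; first by apply/cvg_ex; eexists; exact: lhs.
  by apply/cvg_ex; eexists; exact: rhs.
apply: nearW => k.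
have := backtrack_three_point X_convex g_convex h_subdiff (dca_feasible k)
  (fun i => dca_xi k i) (dca_backtrack k) Xy.
have : 0 <= mu k / 2 * enorm (x k.+1 - x k) ^+ 2.
  by rewrite mulr_ge0 ?sqr_ge0// divr_ge0// (le_trans (ltW mu_low_gt0))// mu_ge.
lra.
Qed.

End sequence.

Theorem theorem1 (R : realType) (m : nat) (n_ : 'I_m -> nat)
  (X : set 'rV[R]_(\sum_(i < m) n_ i)%N)
  (f : 'rV[R]_(\sum_(i < m) n_ i)%N -> R) (L : R)
  (g : forall i : 'I_m, 'rV[R]_(n_ i) -> R)
  (D : 'I_m -> set R) (h : 'I_m -> R -> R)
  (X_closed : closed X)
  (X_convex : convex_set X)
  (f_diff : forall x, differentiable f x)
  (f_C1 : continuous (gradient f))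
  (f_lip : forall x y,
     enorm (gradient f x - gradient f y) <= L * enorm (x - y))
  (g_cont : forall i, continuous (g i))
  (g_convex : forall i, convex_function setT (g i))
  (D_open : forall i, open (D i))
  (D_itv : forall i, is_interval (D i))
  (D_unbounded : forall i, ~ has_ubound (D i))
  (D_g : forall i x, X x -> D i (g i (submxrow x i)))
  (h_concave : forall i, convex_function (D i) (fun t => - h i t))
  (h_nondecr : forall i s t, D i s -> D i t -> s <= t -> h i s <= h i t)
  (h_subdiff : forall i x (t : R), X x -> g i (submxrow x i) <= t ->
     subdiff_neg_h D h i t `<=` [set s | s <= 0])
  (eta delta mu_low : R)
  (eta_gt1 : 1 < eta) (delta_gt0 : 0 < delta) (delta_lt1 : delta < 1)
  (mu_low_gt0 : 0 < mu_low)
  (x : nat -> 'rV[R]_(\sum_(i < m) n_ i)%N) (xi : nat -> 'rV[R]_m)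
  (mu : nat -> R)
  (x_dca : dca_like X f g D h eta delta mu_low x xi mu) :
  [/\ nonincreasing_seq (fun k => phi X f g h (x k, gvec g (x k))) /\
      (forall k,
         ((mu k / 2 * enorm (x k.+1 - x k) ^+ 2)%:E <=
          phi X f g h (x k, gvec g (x k)) -
          phi X f g h (x k.+1, gvec g (x k.+1)))%E),
      (-oo < ereal_inf (range (phi X f g h)))%E ->
        (\sum_(0 <= k <oo) (enorm (x k.+1 - x k) ^+ 2)%:E < +oo)%E /\
        (enorm (x k.+1 - x k) @[k --> \oo] --> (0 : R)) &
      (-oo < ereal_inf (range (phi X f g h)))%E ->
        forall p : 'rV[R]_(\sum_(i < m) n_ i)%N * 'rV[R]_m,
          cluster ((fun k => (x k, gvec g (x k))) @ \oo) p ->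
          critical_point X f g D h L p].
Proof.
have decr := dca_decrease D_g X_convex g_convex h_subdiff x_dca.
have phiE k : phi X f g h (x k, gvec g (x k)) = (feasible_value f g h (x k))%:E.
  by rewrite phi_gvec//; exact: dca_feasible x_dca k.
split.
- split=> [|k]; last by rewrite !phiE -EFinB lee_fin.
  apply/nonincreasing_seqP => k; rewrite !phiE lee_fin -subr_ge0.
  apply: le_trans (decr k); rewrite mulr_ge0 ?sqr_ge0// divr_ge0//.
  exact: le_trans (ltW mu_low_gt0) (mu_ge eta_gt1 mu_low_gt0 x_dca k).
- move=> bounded; split; first exact: (dca_steps_summable _ _ _ _ _ _ x_dca).
  exact: (dca_steps_cvg0 _ _ _ _ _ _ x_dca).
- move=> bounded p.
  exact: (limit_point_critical _ _ _ f_diff _ _ _ _ _ x_dca).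
Qed.
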